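(* Let $(X_a)_{a\in\mathcal A}$ be real-valued random variables with finite moments of all orders, and let $\mu,\kappa\in H^*$ be the moment and cumulant functionals, $\mu(A)=\mathbb{E}(X^A)$ and $\kappa(A)=\mathbf{E}_c(X_A)$ for $A\in\mathcal M(\mathcal A)$. Then $$\mu=\exp^\star(\kappa)=\varepsilon+\sum_{n\ge 1}\frac{1}{n!}\,\kappa^{\star n}.$$
   Context: $(X_a)_{a\in\mathcal A}$ are defined on a common probability space. $\mathcal M(\mathcal A)$ is the set of finitely supported functions $\mathcal A\to\mathbb{N}=\{0,1,2,\dots\}$, a commutative monoid for $(A\cdot B)(a):=A(a)+B(a)$ with neutral element the zero function $\emptyset$; $|B|:=\sum_aB(a)$. For $B\in\mathcal M(\mathcal A)$, $X^B:=\prod_{a:B(a)>0}X_a^{B(a)}$, $X^\emptyset:=1$. For $B,B_1,\dots,B_n\in\mathcal M(\mathcal A)$, $\binom{B}{B_1\dots B_n}:=\mathbf 1_{(B_1\cdots B_n=B)}\prod_{a}\frac{B(a)!}{B_1(a)!\cdots B_n(a)!}$. The cumulants $\mathbf{E}_c(X_B)$, $B\in\mathcal M(\mathcal A)$, are defined inductively over $|B|$ by $\mathbf{E}_c(X_\emptyset)=0$ and, for $B\ne\emptyset$, $$\mathbb{E}(X^B)=\sum_{n=1}^{|B|}\frac1{n!}\sum_{B_1,\dots,B_n\in\mathcal M(\mathcal A)\setminus\{\emptyset\}}\binom{B}{B_1\dots B_n}\prod_{i=1}^n\mathbf{E}_c(X_{B_i}).$$ $H$ is the real vector space freely generated by $\mathcal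 M(\mathcal A)$, with coproduct $\Delta A:=\sum_{B_1,B_2\in\mathcal M(\mathcal A)}\binom{A}{B_1\,B_2}B_1\otimes B_2$ and counit $\varepsilon(A)=\mathbf 1_{(A=\emptyset)}$ for $A\in\mathcal M(\mathcal A)$. The convolution product on $H^*$ is $(f\star g)(A):=(f\otimes g)\Delta A$, with unit $\varepsilon$; $\kappa^{\star n}$ is the $n$-fold convolution power. The infinite sum is pointwise: on any element of $H$ only finitely many terms are nonzero. *)

(* Defs.v *)
From HB Require Import structures.
From mathcomp Require Import all_boot all_order all_algebra finmap.
From mathcomp Require Import all_classical all_reals all_analysis.
(* The notations of monalg cannot be parsed together with those of
   mathcomp-analysis. *)
From mathcomp.multinomials Require Import -(notations) monalg.

Set Implicit Arguments.
Unset Strict Implicit.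
Unset Printing Implicit Defensive.

Import Order.TTheory GRing.Theory Num.Theory.

Local Open Scope classical_set_scope.
Local Open Scope ring_scope.

(* [cmonom I] is the commutative monoid of finitely supported functions from I
   to nat, written multiplicatively: [mone] is the zero function and
   [mdeg B] is the sum of the values of B. *)
Notation mone := (@monalg.one (cmonom _)).
Notation mmul := (@monalg.mul (cmonom _)).

Section Monomials.
Context {I : choiceType}.
Local Notation M := (cmonom I).
Implicit Types (B C : M) (s : seq M).

Definition mprod s : M := \big[mmul/mone]_(C <- s) C.

(* For a outside the support of B the factor at a equals 1 as soon as
   mprod s = B. *)
Definition multibinom {R : realType} B s : R :=
  (mprod s == B)%:R *
  \prod_(a <- finsupp B) ((B a)`!%:R / \prod_(C <- s) (C a)`!%:R).

(* The sums \sum_(t \in D) over infinite sets D used below have finitely many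
   nonzero terms (the library sets them to 0 otherwise) by the lemmas
   [finite_factor] and [finite_factor2]. *)
Lemma finite_divisors B : finite_set [set C : M | forall a, (C a <= B a)%N].
Proof.
pose D := finsupp B.
pose h (f : {ffun D -> 'I_(mdeg B).+1}) (i : I) : nat :=
  if insub i : option D is Some j then (f j : nat) else 0%N.
pose g f : M := cmonom_of_fsfun cmonom_key [fsfun i in D => h f i | 0%N].
apply: (@sub_finite_set _ _ (range g)); last exact/finite_image/finite_finset.
move=> C /= CB.
exists [ffun j : D => inord (C (val j))] => //.
apply/eqP/cmP => i; rewrite /g cmE fsfunE /h.
case: ifPn => [iD|iD].
  rewrite insubT /= ffunE /= inordK // ltnS (leq_trans (CB i)) //.
  by rewrite mdegE (big_fsetD1 i) //= leq_addr.
apply/esym/eqP; rewrite -leqn0 (leq_trans (CB i)) //.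
by rewrite leqn0 cmE_eq0.
Qed.

Lemma finite_factor n B : finite_set [set t : n.-tuple M | mprod t = B].
Proof.
pose S := [set C : M | forall a, (C a <= B a)%N].
suff fin k : finite_set [set t : k.-tuple M | forall i, S (tnth t i)].
  apply: sub_finite_set (fin n) => t /= tB i a.
  rewrite -tB /mprod big_tuple (bigD1 i) //= cmM; exact: leq_addr.
elim: k => [|k IHk].
  by apply: (@sub_finite_set _ _ [set [tuple]]) => // t _; rewrite (tuple0 t).
apply: (@sub_finite_set _ _
  ((fun p : M * k.-tuple M => cons_tuple p.1 p.2) @`
     (S `*` [set t : k.-tuple M | forall i, S (tnth t i)]))); last first.
  by apply: finite_image; apply: finite_setX => //; exact: finite_divisors.
move=> t /= tS; exists (thead t, behead_tuple t).
  split => /=; first exact: tS.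
  by move=> i; rewrite tnth_behead; exact: tS.
by rewrite /= [RHS]tuple_eta.
Qed.

Lemma finite_factor2 B : finite_set [set p : M * M | mprod [:: p.1; p.2] = B].
Proof.
pose g (t : 2.-tuple M) : M * M := (tnth t ord0, tnth t ord_max).
apply: sub_finite_set (finite_image g (finite_factor 2 B)).
by move=> [x y] /= xy; exists [tuple x; y].
Qed.

Definition cumulant_term {R : realType} (c : M -> R) B n : R :=
  n`!%:R^-1 *
    \sum_(t \in [set t : n.-tuple M | forall i, tnth t i <> mone])
      (multibinom B t * \prod_(C <- t) c C).

Definition is_cumulant {R : realType} (m c : M -> R) : Prop :=
  c mone = 0 /\
  forall B, B <> mone ->
    m B = \sum_(1 <= n < (mdeg B).+1) cumulant_term c B n.

Lemma cumulant_term1 {R : realType} (c : M -> R) B :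
  B <> mone -> cumulant_term c B 1 = c B.
Proof.
move=> B1; rewrite /cumulant_term invr1 mul1r.
rewrite (fsbigE [:: [tuple B]]) //=; last 2 first.
- by move=> t /=; rewrite inE => /eqP -> i; rewrite ord1.
- case/tupleP=> C t; rewrite (tuple0 t) => _ CB; rewrite /multibinom.
  case: eqP => [e|_]; last by rewrite !mul0r.
  move: CB; rewrite inE -e /mprod /= big_seq1 => /eqP[].
  exact: val_inj.
rewrite big_mkcond big_seq1 mem_set; last by move=> i; rewrite ord1.
rewrite big_seq1 /multibinom /mprod big_seq1 eqxx mul1r big1 ?mul1r // => a _.
by rewrite big_seq1 divff // pnatr_eq0 -lt0n fact_gt0.
Qed.

Lemma eq_cumulant_term {R : realType} (c c' : M -> R) B n :
  (1 < n)%N -> (forall C, (mdeg C < mdeg B)%N -> c C = c' C) ->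
  cumulant_term c B n = cumulant_term c' B n.
Proof.
move=> n1 cc'; congr (_ * _); apply: eq_fsbigr => t; rewrite inE => t1.
rewrite /multibinom; case: eqP => [tB|]; last by rewrite !mul0r.
congr (_ * _); rewrite !big_tuple; apply: eq_bigr => i _; apply: cc'.
have [j ji] : exists j : 'I_n, j != i.
  case: n n1 t t1 tB i => [|[|n]] // _ t t1 tB i.
  by case: (eqVneq ord0 i) => [<-|]; [exists ord_max | exists ord0].
rewrite -tB /mprod mdeg_prod big_tuple (bigD1 i) //= (bigD1 j) //=.
rewrite -[X in (X < _)%N]addn0 ltn_add2l ltn_addr // lt0n mdeg_eq0.
exact/eqP/t1.
Qed.

Definition cumulant_step {R : realType} (m c : M -> R) B : R :=
  if B == mone then 0
  else m B - \sum_(2 <= n < (mdeg B).+1) cumulant_term c B n.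

Lemma is_cumulantP {R : realType} (m c : M -> R) :
  is_cumulant m c <-> c =1 cumulant_step m c.
Proof.
have split_sum B : B <> mone -> \sum_(1 <= n < (mdeg B).+1) cumulant_term c B n
    = c B + \sum_(2 <= n < (mdeg B).+1) cumulant_term c B n.
  move=> B1; rewrite big_ltn ?cumulant_term1 // ltnS lt0n mdeg_eq0; exact/eqP.
split=> [[c0 cE] B|cE]; rewrite /cumulant_step.
  by case: eqP => [->//|B1]; rewrite cE // split_sum // addrK.
split=> [|B B1]; first by rewrite cE /cumulant_step eqxx.
by rewrite split_sum // [c B]cE /cumulant_step; case: eqP => // _; rewrite subrK.
Qed.

Lemma eq_cumulant_step {R : realType} (m c c' : M -> R) B :
  (forall C, (mdeg C < mdeg B)%N -> c C = c' C) ->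
  cumulant_step m c B = cumulant_step m c' B.
Proof.
move=> cc'; rewrite /cumulant_step; case: ifP => // _; congr (_ - _).
by apply: eq_big_nat => n /andP[n1 _]; exact: eq_cumulant_term.
Qed.

Lemma cumulant_exists {R : realType} (m : M -> R) : exists c, is_cumulant m c.
Proof.
pose u k := iter k (cumulant_step m) (fun=> 0).
have stable k l B : (mdeg B < k)%N -> (mdeg B < l)%N -> u k B = u l B.
  elim: k l B => // k IHk [//|l] B; rewrite !ltnS => Bk Bl.
  rewrite /u !iterS; apply: eq_cumulant_step => C CB.
  by apply: IHk; apply: leq_trans CB _.
exists (fun B => u (mdeg B).+1 B); apply/is_cumulantP => B.
by apply: eq_cumulant_step => C CB; exact: stable.
Qed.

Lemma cumulant_unique {R : realType} (m c c' : M -> R) :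
  is_cumulant m c -> is_cumulant m c' -> c =1 c'.
Proof.
move=> /is_cumulantP cE /is_cumulantP cE' B.
have [k] := ubnP (mdeg B); elim: k B => // k IHk B; rewrite ltnS => Bk.
rewrite cE cE'; apply: eq_cumulant_step => C CB.
by apply: IHk; apply: leq_trans CB _.
Qed.

(* The unique function satisfying the inductive definition [is_cumulant]. *)
Definition cumulant {R : realType} (m : M -> R) : M -> R :=
  projT1 (cid (cumulant_exists m)).

Lemma cumulantP {R : realType} (m : M -> R) : is_cumulant m (cumulant m).
Proof. exact: projT2 (cid (cumulant_exists m)). Qed.

End Monomials.

(* [malg K R] is the free R-module on K; H is [malg (cmonom I) R]. *)
Section LinearExtension.
Context {K : choiceType} {R : realType} {V : lmodType R}.

Definition freevec (k : K) : malg K R := mkmalgU k 1.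

Variable f : K -> V.

Definition linext (h : malg K R) : V := \sum_(k <- msupp h) mcoeff k h *: f k.

Lemma linextEw (D : {fset K}) h : (msupp h `<=` D)%fset ->
  linext h = \sum_(k <- D) mcoeff k h *: f k.
Proof.
move=> hD; rewrite /linext (big_fset_incl _ hD) // => k _ kh.
by rewrite mcoeff_outdom // scale0r.
Qed.

Lemma linext_is_linear : linear linext.
Proof.
move=> a g h; pose D := (msupp g `|` msupp h)%fset.
have gD : (msupp g `<=` D)%fset by exact: fsubsetUl.
have hD : (msupp h `<=` D)%fset by exact: fsubsetUr.
have sD : (msupp (a *: g + h) `<=` D)%fset.
  apply: fsubset_trans (msuppD_le _ _) _.
  by rewrite fsubUset hD (fsubset_trans (msuppZ_le _ _)).
rewrite (linextEw sD) (linextEw gD) (linextEw hD) scaler_sumr -big_split /=.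
by apply: eq_bigr => k _; rewrite mcoeffD mcoeffZ scalerDl scalerA.
Qed.

HB.instance Definition _ :=
  GRing.isLinear.Build R (malg K R) V _ linext linext_is_linear.

Lemma linextE k : linext (freevec k) = f k.
Proof.
by rewrite (linextEw msuppU_le) big_seq_fset1 /freevec mcoeffUU scale1r.
Qed.

End LinearExtension.

Section ConvolutionAlgebra.
Context {I : choiceType} {R : realType}.
Local Notation M := (cmonom I).
Local Notation H := (malg M R).
(* H (x) H is realized as the free vector space on M * M, the basis vector
   (B1, B2) being B1 (x) B2. *)
Local Notation HH := (malg (M * M)%type R).
Local Notation dual := {linear H -> R^o}.

Definition coproduct : {linear H -> HH} :=
  linext (fun A : M =>
    \sum_(p \in [set: M * M]) (multibinom A [:: p.1; p.2] : R) *: freevec p).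

Definition counit : dual := linext (fun A : M => (A == mone)%:R : R^o).

Definition tensor (f g : dual) : {linear HH -> R^o} :=
  linext (fun p : M * M => f (freevec p.1) * g (freevec p.2) : R^o).

Definition conv (f g : dual) : dual := tensor f g \o coproduct.

Definition convpow (f : dual) n : dual := iter n (conv f) counit.

(* Meaningful when, for each h, finitely many terms of the sum are nonzero
   (see [locally_finite]). *)
Definition convexp (f : dual) (h : H) : R :=
  counit h + \sum_(n \in [set n : nat | (1 <= n)%N]) n`!%:R^-1 * convpow f n h.

Definition locally_finite (f : dual) : Prop :=
  forall h : H, finite_set [set n : nat | convpow f n h <> 0].

End ConvolutionAlgebra.

Section Functionals.
Context d {T : measurableType d} {R : realType} (P : probability T R).
Context {I : choiceType} (X : I -> {RV P >-> R}).

Definition monomialRV (B : cmonom I) (w : T) : R :=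
  \prod_(a <- finsupp B) X a w ^+ B a.

Definition moment (B : cmonom I) : R := fine 'E_P[monomialRV B].

Definition finite_moments : Prop :=
  forall a n, P.-integrable [set: T] (EFin \o (fun w => X a w ^+ n)).

Definition moment_functional : {linear malg (cmonom I) R -> R^o} :=
  linext (moment : _ -> R^o).

Definition cumulant_functional : {linear malg (cmonom I) R -> R^o} :=
  linext (cumulant moment : _ -> R^o).

End Functionals.

Arguments monomialRV {d T R} P {I} X B w.
Arguments moment {d T R} P {I} X B.
Arguments finite_moments {d T R} P {I} X.
Arguments moment_functional {d T R} P {I} X.
Arguments cumulant_functional {d T R} P {I} X.

(* Main.v *)
(* On a basis vector B, the n-th convolution power of a functional expands into
   the sum over all factorizations of B into n factors, because multinomial
   coefficients factor along B = C (B_1 ... B_n). As the cumulant of the unit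
   vanishes, only factorizations without trivial factor contribute; hence the
   powers n > |B| vanish, and the exponential series at B is the recursion that
   defines the cumulants. *)
Require Import Defs.
From HB Require Import structures.
From mathcomp Require Import all_boot all_order all_algebra finmap.
From mathcomp Require Import all_classical all_reals all_analysis.
From mathcomp.multinomials Require Import -(notations) monalg.

Import Order.TTheory GRing.Theory Num.Theory.

Local Open Scope classical_set_scope.
Local Open Scope ring_scope.

Section Multibinomial.
Context {I : choiceType} {R : realType}.
Local Notation M := (cmonom I).
Implicit Types (B C : M) (s : seq M).

Lemma mprod_cons C s : mprod (C :: s) = mmul C (mprod s).
Proof. by rewrite /mprod big_cons. Qed.

Lemma mprod_pair C B : mprod [:: C; B] = mmul C B.
Proof. by rewrite /mprod big_cons big_seq1. Qed.

Lemma leq_mprod s C a : C \in s -> (C a <= mprod s a)%N.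
Proof.
elim: s => // D s IHs; rewrite mprod_cons cmM inE => /orP[/eqP->|/IHs Ca].
  exact: leq_addr.
exact: leq_trans Ca (leq_addl _ _).
Qed.

Lemma multibinom_neq B s : mprod s <> B -> multibinom B s = 0 :> R.
Proof. by move/eqP/negPf => sB; rewrite /multibinom sB mul0r. Qed.

(** Coefficients attached to different monomials can then be compared over a common index set: when
    the factors multiply to [B], each exponent is at most that of [B], so outside [finsupp B] only
    factors 0!/(0!...0!) = 1 are added. *)
Lemma multibinomEw (D : {fset I}) B s : (finsupp B `<=` D)%fset ->
  multibinom B s = (mprod s == B)%:R *
    \prod_(a <- D) ((B a)`!%:R / \prod_(C <- s) (C a)`!%:R) :> R.
Proof.
move=> BD; rewrite /multibinom; case: eqP => [sB|_]; last by rewrite !mul0r.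
congr (_ * _); apply: big_fset_incl => // a _.
rewrite -cmE_eq0 => /eqP Ba; rewrite Ba big_seq big1 ?divr1 // => C Cs.
by have := leq_mprod s C a Cs; rewrite sB Ba leqn0 => /eqP ->.
Qed.

Lemma multibinom_nil B : multibinom B [::] = (B == mone)%:R :> R.
Proof.
rewrite /multibinom /mprod big_nil eq_sym; case: eqP => [->|_].
  rewrite mul1r big1_seq // => a _; rewrite cm1 big_nil divr1 //.
by rewrite mul0r.
Qed.

(** The factorials of [mprod s] cancel between the two coefficients on the right. If C times
    [mprod s] is not [B], both sides vanish. *)
Lemma multibinom_cons B C s : multibinom B (C :: s) =
  multibinom B [:: C; mprod s] * multibinom (mprod s) s :> R.
Proof.
have [CsB|CsB] := eqVneq (mmul C (mprod s)) B; last first.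
  rewrite !(multibinom_neq B) ?mul0r // ?mprod_pair ?mprod_cons; exact/eqP.
have sB : (finsupp (mprod s) `<=` finsupp B)%fset.
  apply/fsubsetP => a; rewrite -!cmE_neq0 -CsB cmM -!lt0n => h.
  exact: leq_trans h (leq_addl _ _).
rewrite (multibinomEw (finsupp B) (mprod s)) // /multibinom.
rewrite mprod_pair mprod_cons CsB !eqxx !mul1r -big_split /=.
apply: eq_bigr => a _; rewrite !big_cons big_nil mulr1 !invfM !mulrA.
by rewrite mulfVK // pnatr_eq0 -lt0n fact_gt0.
Qed.

(** Such tuples are the tails of factorizations of [B] into n+1 factors. This gives an inner index
    set that does not depend on the outer pair, as merging the double sum requires. *)
Lemma finite_cofactor n B :
  finite_set [set t : n.-tuple M | exists C, mmul C (mprod t) = B].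
Proof.
apply: (@sub_finite_set _ _
  ((fun t : n.+1.-tuple M => behead_tuple t) @`
     [set t : n.+1.-tuple M | mprod t = B])).
  by move=> t [C CB]; exists (cons_tuple C t); [rewrite /= mprod_cons|exact: val_inj].
exact/finite_image/finite_factor.
Qed.

(** Induction step for convolution powers: splitting [B] in two and then factoring the second part
    into n pieces amounts to factoring [B] into n+1 pieces. *)
Lemma fsum_multibinom_cons n B (F : M -> R) (G : n.-tuple M -> R) :
  \sum_(p \in [set: M * M]) multibinom B [:: p.1; p.2] *
    (F p.1 * \sum_(t \in [set: n.-tuple M]) multibinom p.2 t * G t) =
  \sum_(t \in [set: n.+1.-tuple M])
    multibinom B t * (F (thead t) * G (behead_tuple t)).
Proof.
pose P := [set p : M * M | mprod [:: p.1; p.2] = B].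
pose Q := [set t : n.-tuple M | exists C, mmul C (mprod t) = B].
pose S := [set t : n.+1.-tuple M | mprod t = B].
pose h (t : n.+1.-tuple M) : (M * M) * n.-tuple M :=
  ((thead t, mprod (behead_tuple t)), behead_tuple t).
pose K (p : M * M) (t : n.-tuple M) : R :=
  multibinom B [:: p.1; p.2] * (F p.1 * (multibinom p.2 t * G t)).
have Pfin : finite_set P by exact: finite_factor2.
have Qfin : finite_set Q by exact: finite_cofactor.
have hS t : S t -> mmul (thead t) (mprod (behead t)) = B.
  by move=> <-; case/tupleP: t => C t; rewrite /S /= mprod_cons theadE.
transitivity (\sum_(p \in P) \sum_(t \in Q) K p t).
  rewrite -(@fsbig_widen _ _ _ _ P) //; last first.
    by move=> p [_] /= /multibinom_neq ->; rewrite mul0r.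
  apply: eq_fsbigr => p; rewrite inE => Pp.
  rewrite -(@fsbig_widen _ _ _ _ Q) //; last first.
    move=> t [_ Qt] /=; rewrite multibinom_neq ?mul0r // => tp.
    by apply: Qt; exists p.1; rewrite tp -mprod_pair.
  by rewrite !mulr_fsumr; apply: eq_fsbigr.
rewrite pair_fsbig //.
rewrite -[RHS](@fsbig_widen _ _ _ _ S) //; last first.
  by move=> t [_] /= /multibinom_neq ->; rewrite mul0r.
(* A nonzero [K p t] forces [p.2] to be the product of [t] and [p.1] times [p.2] to be [B], which
   places the pair in the image of [h]. *)
rewrite -(@fsbig_widen _ _ _ _ (h @` S)); last 2 first.
- move=> _ [t St <-]; split => /=; last by exists (thead t); exact: hS.
  by rewrite /P /= mprod_pair hS.
- move=> [[C D] t] [/= [PCD _] NhS]; rewrite /K /=.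
  rewrite [X in _ * (_ * (X * _))]multibinom_neq ?mul0r ?mulr0 // => tD.
  apply: NhS; exists (cons_tuple C t).
    by rewrite /S /= mprod_cons tD -mprod_pair.
  by rewrite /h theadE (_ : behead_tuple (cons_tuple C t) = t) ?tD //; exact: val_inj.
(* [h] is injective because it retains both head and tail. *)
rewrite fsbig_image; last first.
  move=> t u _ _ [tu _ btu]; apply: val_inj.
  by rewrite (tuple_eta t) (tuple_eta u) /= tu btu.
apply: eq_fsbigr => t; rewrite inE => St; rewrite /K /h /=.
rewrite [in RHS](_ : tval t = thead t :: behead t); last first.
  by rewrite [t in LHS]tuple_eta.
by rewrite [in RHS]multibinom_cons -[RHS]mulrA; congr (_ * _); exact: mulrCA.
Qed.

End Multibinomial.

Section LinearFunctionals.
Context {K : choiceType} {R : realType}.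

Lemma linext_freevec (V : lmodType R) (phi : {linear malg K R -> V}) :
  phi =1 linext (phi \o freevec).
Proof.
move=> h; rewrite {1}[h]monalgE linear_sum; apply: eq_bigr => k _.
rewrite -linearZ; congr (phi _); apply/malgP => l.
by rewrite mcoeffZ !mcoeffU mulr_natr.
Qed.

End LinearFunctionals.

Section ConvolutionPowers.
Context {I : choiceType} {R : realType}.
Local Notation M := (cmonom I).
Local Notation dual := {linear malg M R -> R^o}.
Implicit Types (B C : M) (f g : dual).

Lemma conv_freevec f g B : Defs.conv f g (freevec B) =
  \sum_(p \in [set: M * M]) multibinom B [:: p.1; p.2] *
    (f (freevec p.1) * g (freevec p.2)).
Proof.
(* Restricting to a fixed finite set turns the sum into an ordinary one, through which linear maps
   pass. *)
have widen (V : lmodType R) (u : M * M -> V) :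
    \sum_(p \in [set: M * M]) (multibinom B [:: p.1; p.2] : R) *: u p =
    \sum_(p \in [set p : M * M | mprod [:: p.1; p.2] = B])
      (multibinom B [:: p.1; p.2] : R) *: u p.
  rewrite -(@fsbig_widen _ _ _ _ [set p : M * M | mprod [:: p.1; p.2] = B]) //.
  by move=> p [_] /= /multibinom_neq ->; rewrite scale0r.
have fin := finite_factor2 B.
rewrite /Defs.conv /= linextE widen (widen R^o) !fsbig_finite // linear_sum.
by apply: eq_bigr => p _; rewrite linearZ /= linextE.
Qed.

Lemma convpow_freevec f n B : convpow f n (freevec B) =
  \sum_(t \in [set: n.-tuple M])
    multibinom B t * \prod_(C <- t) f (freevec C).
Proof.
elim: n B => [|n IHn] B.
  rewrite /convpow /= linextE -multibinom_nil.
  have -> : [set: 0.-tuple M] = [set [tuple]].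
    by apply/seteqP; split=> // t _; rewrite (tuple0 t).
  by rewrite fsbig_set1 big_nil mulr1.
rewrite /convpow iterS conv_freevec -/(convpow f n).
under eq_fsbigr do rewrite IHn.
rewrite (@fsum_multibinom_cons I R n B (fun C => f (freevec C))
  (fun t => \prod_(C <- t) f (freevec C))).
apply: eq_fsbigr => t _; congr (_ * _).
by rewrite [t in RHS]tuple_eta big_cons.
Qed.

Lemma convpow_freevec_cumulant (c : M -> R) n B : c mone = 0 ->
  n`!%:R^-1 * convpow (linext (c : M -> R^o)) n (freevec B) =
  cumulant_term c B n.
Proof.
move=> c1; rewrite convpow_freevec /cumulant_term; congr (_ * _).
under eq_fsbigr do under eq_bigr do rewrite /= linextE.
(* A tuple with a trivial entry contributes 0, since its product contains the factor [c mone]. *)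
symmetry; apply: fsbig_widen => // t [_] /= /existsNP[i] /contrapT ti.
by rewrite big_tuple (bigD1 i) //= ti c1 mul0r mulr0.
Qed.

(** Each of n nontrivial factors has degree at least 1, so their product has degree at least n. *)
Lemma cumulant_term_gt (c : M -> R) n B : (mdeg B < n)%N ->
  cumulant_term c B n = 0.
Proof.
move=> Bn; rewrite /cumulant_term fsbig1 ?mulr0 // => t t1.
rewrite multibinom_neq ?mul0r // => tB; move: Bn; rewrite ltnNge => /negP; apply.
rewrite -tB /mprod mdeg_prod big_tuple -[X in (X <= _)%N]card_ord -sum1_card.
by apply: leq_sum => i _; rewrite lt0n mdeg_eq0; exact/eqP/t1.
Qed.

Lemma convpow_gt (c : M -> R) n (h : malg M R) : c mone = 0 ->
  (\max_(B <- msupp h) mdeg B < n)%N ->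
  convpow (linext (c : M -> R^o)) n h = 0.
Proof.
move=> c1 hn; rewrite linext_freevec /linext big_seq big1 // => B Bh /=.
have Bn : (mdeg B < n)%N by apply: leq_ltn_trans hn; exact: leq_bigmax_seq.
apply/eqP; rewrite scaler_eq0; apply/orP; right.
(* The vanishing term is 1/n! times the power at [B], and n! is nonzero. *)
have /eqP := cumulant_term_gt c n B Bn.
rewrite -convpow_freevec_cumulant // mulf_eq0 invr_eq0 pnatr_eq0.
by rewrite -[_ == 0%N]negbK -lt0n fact_gt0.
Qed.

(** The counit is absorbed as the term n = 0. *)
Lemma convexp_bounded f h N : (forall n, (N < n)%N -> convpow f n h = 0) ->
  convexp f h = \sum_(0 <= n < N.+1) n`!%:R^-1 * convpow f n h.
Proof.
move=> fN; rewrite big_ltn // invr1 mul1r; congr (_ + _).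
rewrite (@fsbigE _ _ _ _ _ (index_iota 1 N.+1)) ?iota_uniq //=; last 2 first.
- by move=> n /=; rewrite mem_index_iota => /andP[].
- move=> n n1; rewrite mem_index_iota n1 -leqNgt => /fN ->.
  by rewrite mulr0.
rewrite big_mkcond big_nat [RHS]big_nat; apply: eq_bigr => n /andP[n1 _].
by rewrite mem_set.
Qed.

(** Allowing any cutoff [N] above the degree lets all basis vectors in the support of an element
    share one range of summation. *)
Lemma moment_cumulant (m c : M -> R) N B : m mone = 1 -> is_cumulant m c ->
  (mdeg B <= N)%N -> m B = \sum_(0 <= n < N.+1) cumulant_term c B n.
Proof.
move=> m1 [c1 mE] BN.
rewrite (@big_cat_nat _ _ _ (mdeg B).+1) //= [X in _ + X]big_nat.
rewrite [X in _ + X]big1 ?addr0; last first.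
  by move=> n /andP[Bn _]; exact: cumulant_term_gt.
(* The term n = 0 is the counit at [B]: it supplies [m mone] = 1 when [B] is [mone], where the
   remaining sum is empty, and is 0 otherwise. *)
rewrite big_ltn // -convpow_freevec_cumulant // invr1 mul1r /= linextE.
have [->|/eqP B1] := eqVneq B mone; last by rewrite add0r mE.
by rewrite m1 mdeg1 big_geq ?addr0.
Qed.

Lemma linext_moment_convexp (m c : M -> R) : m mone = 1 -> is_cumulant m c ->
  linext (m : M -> R^o) =1 convexp (linext (c : M -> R^o)).
Proof.
move=> m1 mc h; have c1 := mc.1.
rewrite (@convexp_bounded _ _ (\max_(B <- msupp h) mdeg B)); last first.
  by move=> n; exact: convpow_gt.
under [RHS]eq_bigr do rewrite linext_freevec /linext mulr_sumr.
(* Both sums are now finite, so the identity can be checked on each basis vector of the support. *)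
rewrite exchange_big [LHS]big_seq [RHS]big_seq /=; apply: eq_bigr => B Bh.
rewrite (@moment_cumulant m c (\max_(B <- msupp h) mdeg B)) //; last first.
  exact: leq_bigmax_seq.
rewrite scaler_sumr; apply: eq_bigr => n _.
by rewrite -convpow_freevec_cumulant // -mulrCA.
Qed.

Lemma linext_locally_finite (c : M -> R) : c mone = 0 ->
  locally_finite (linext (c : M -> R^o)).
Proof.
move=> c1 h; apply: (@sub_finite_set _ _ `I_(\max_(B <- msupp h) mdeg B).+1).
  by move=> n /= hn; rewrite ltnS leqNgt; apply/negP => /(convpow_gt _ _ _ c1).
exact: finite_II.
Qed.

End ConvolutionPowers.

Lemma moment_mone (d : measure_display) (T : measurableType d)
    (R : realType) (P : probability T R) (I : choiceType)
    (X : I -> {RV P >-> R}) : moment P X mone = 1.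
Proof.
rewrite /moment (_ : monomialRV P X mone = cst 1) ?expectation_cst //.
by apply/funext => w; rewrite /monomialRV big1_seq // => a _; rewrite cm1.
Qed.

Theorem proposition3p5 (d : measure_display) (T : measurableType d)
    (R : realType) (P : probability T R) (I : choiceType)
    (X : I -> {RV P >-> R}) (Xfin : finite_moments P X) :
  locally_finite (cumulant_functional P X) /\
  moment_functional P X =1 convexp (cumulant_functional P X).
Proof.
have mc := cumulantP (moment P X).
split; first exact: linext_locally_finite mc.1.
exact: linext_moment_convexp (moment_mone _ _ _ _ _ _) mc.
Qed.
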